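(* Let $R$ be a principal ideal ring (commutative with identity, not necessarily an integral domain), let $n\geq 3$ and let $A\in\mathfrak{sl}_n(R)$. Then there exist $X,Y\in\mathfrak{sl}_n(R)$ such that $XY-YX=A$. Moreover, $X$ can be chosen such that, for every maximal ideal $\mathfrak p$ of $R$, the image of $X$ in $\mathfrak{gl}_n(R/\mathfrak p)$ is $\mathfrak{gl}_n(R/\mathfrak p)$-regular.
   Context: $\mathfrak{gl}_n(S)$ denotes the $n\times n$ matrices over a commutative ring $S$ and $\mathfrak{sl}_n(S)$ the trace zero matrices. For a field $K$, $X\in\mathfrak{gl}_n(K)$ is $\mathfrak{gl}_n(K)$-regular if its centraliser in $\mathfrak{gl}_n(K)$ equals the unital algebra $K[X]$ generated by $X$ (equivalently, the centraliser has dimension $n$). *)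

(* Defs.v *)
From HB Require Import structures.
From mathcomp Require Import all_boot all_order all_algebra.
From mathcomp Require Import boolp classical_sets.

Set Implicit Arguments.
Unset Strict Implicit.
Unset Printing Implicit Defensive.

Import GRing.Theory.

Local Open Scope classical_set_scope.
Local Open Scope ring_scope.

Definition is_ideal (R : comPzRingType) (I : set R) : Prop :=
  [/\ I 0,
      forall x y, I x -> I y -> I (x + y)
    & forall a x, I x -> I (a * x)].

(* R may have zero divisors, and the zero ring is allowed. *)
Definition principal_ideal_ring (R : comPzRingType) : Prop :=
  forall I : set R, is_ideal I -> exists a : R, I = [set b * a | b in setT].

Definition is_maximal_ideal (R : comPzRingType) (I : set R) : Prop :=
  [/\ is_ideal I,
      I <> setT
    & forall J : set R, is_ideal J -> I `<=` J -> J = I \/ J = setT].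

Record maximal_ideal (R : comPzRingType) := MaximalIdeal {
  maximal_ideal_set :> set R;
  maximal_idealP : is_maximal_ideal maximal_ideal_set
}.

Section ResidueField.
Variables (R : comPzRingType) (p : maximal_ideal R).

Lemma maximal_ideal_not1 : ~ (p : set R) 1.
Proof.
have [[_ _ pM] p_proper _] := maximal_idealP p.
move=> p1; apply: p_proper.
by apply/seteqP; split=> // x _; rewrite -[x]mulr1; apply: pM.
Qed.

Lemma maximal_ideal_oner_neq0 : (1 : R) != 0.
Proof.
have [[p0 _ _] _ _] := maximal_idealP p.
by apply/eqP => e; apply: maximal_ideal_not1; rewrite e.
Qed.

(* R itself: ring_quotient only forms quotients of nontrivial rings, and the
   existence of p shows that R is one. *)
Definition nontrivial_ring : comNzRingType :=
  HB.pack (GRing.ComPzRing.sort R)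
    (GRing.PzSemiRing_isNonZero.Build R maximal_ideal_oner_neq0).

Definition maximal_ideal_pred (x : nontrivial_ring) : bool :=
  `[< (p : set R) x >].

Lemma maximal_ideal_closed :
  idealr_closed (maximal_ideal_pred : {pred nontrivial_ring}).
Proof.
have [[p0 pD pM] _ _] := maximal_idealP p.
split; first exact/asboolP.
- by apply/negP => /asboolP; apply: maximal_ideal_not1.
- move=> a u v /asboolP pu /asboolP pv.
  by apply/asboolP; apply: pD => //; apply: pM.
Qed.

HB.instance Definition _ :=
  isIdealr.Build nontrivial_ring maximal_ideal_pred maximal_ideal_closed.

Local Notation quotient_ring :=
  {ideal_quot (maximal_ideal_pred : idealr nontrivial_ring)}.

Definition residue_field : Type := quotient_ring.

HB.instance Definition _ := GRing.ComNzRing.on residue_field.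

Definition residue (x : R) : residue_field :=
  (\pi_quotient_ring (x : nontrivial_ring))%qT.

Fact residue_zmod_morphism : zmod_morphism residue.
Proof. by move=> x y; rewrite /residue -rmorphB. Qed.

Fact residue_monoid_morphism : monoid_morphism residue.
Proof.
split=> [|x y]; rewrite /residue -?rmorphM //.
by rewrite -[RHS](rmorph1 (\pi_quotient_ring)%qT).
Qed.

HB.instance Definition _ :=
  GRing.isZmodMorphism.Build R residue_field residue residue_zmod_morphism.
HB.instance Definition _ :=
  GRing.isMonoidMorphism.Build R residue_field residue residue_monoid_morphism.

Lemma residue_surj (y : residue_field) : exists x, residue x = y.
Proof. by exists (repr y); rewrite /residue reprK. Qed.

Lemma residue_eq0 (x : R) : residue x = 0 <-> (p : set R) x.
Proof.
rewrite -[0](rmorph0 residue).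
have -> : (residue x = residue 0) <-> (residue x == residue 0).
  by split=> /eqP.
by rewrite /residue -Quotient.idealrBE subr0; split=> /asboolP.
Qed.

Lemma residue_inv_exists (y : residue_field) : y != 0 -> exists z, z * y = 1.
Proof.
have [[p0 pD pM] _ p_max] := maximal_idealP p.
have [x <-] := residue_surj y => /eqP xN0.
pose J : set R := [set u | exists a b, (p : set R) b /\ u = a * x + b].
have J_ideal : is_ideal J.
  split.
  - by exists 0, 0; rewrite mul0r addr0.
  - move=> _ _ [a [b [pb ->]]] [c [d [pd ->]]].
    by exists (a + c), (b + d); split; [exact: pD | rewrite mulrDl addrACA].
  - move=> c _ [a [b [pb ->]]].
    by exists (c * a), (c * b); split; [exact: pM | rewrite mulrDr mulrA].
have pJ : p `<=` J by move=> b pb; exists 0, b; rewrite mul0r add0r.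
have [Jp|JT] := p_max J J_ideal pJ.
  case: xN0; apply/residue_eq0; rewrite -Jp.
  by exists 1, 0; rewrite mul1r addr0.
have [a [b [pb e]]] : J 1 by rewrite JT.
exists (residue a); rewrite -rmorphM -[1](rmorph1 residue) e rmorphD /=.
by rewrite [residue b](iffRL (residue_eq0 b) pb) addr0.
Qed.

Definition residue_inv (y : residue_field) : residue_field :=
  xget 0 [set z | z * y = 1].

Fact residue_mulVf (y : residue_field) : y != 0 -> residue_inv y * y = 1.
Proof.
move=> /residue_inv_exists [z zy].
by apply: (xgetPex 0 (P := [set z | z * y = 1])); exists z.
Qed.

Fact residue_inv0 : residue_inv 0 = 0.
Proof.
apply: xgetPN => z /=; rewrite mulr0 => /eqP.
by rewrite eq_sym oner_eq0.
Qed.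

HB.instance Definition _ :=
  GRing.ComNzRing_isField.Build residue_field residue_mulVf residue_inv0.

End ResidueField.

Definition sl (n : nat) (R : comPzRingType) : set 'M[R]_n :=
  [set X | \tr X = 0].
Arguments sl : clear implicits.

Definition centraliser (K : fieldType) (n : nat) (X : 'M[K]_n) : set 'M[K]_n :=
  [set Z | comm_mx Z X].

(* K[X], written out because horner_mx needs a size of the form n.+1. *)
Definition generated_algebra (K : fieldType) (n : nat) (X : 'M[K]_n) :
    set 'M[K]_n :=
  [set \sum_(i < size q) q`_i *: X ^+ i | q in [set: {poly K}]].

Lemma generated_algebraE (K : fieldType) (n : nat) (X : 'M[K]_n.+1) :
  generated_algebra X = [set horner_mx X q | q in [set: {poly K}]].
Proof.
have h (q : {poly K}) : \sum_(i < size q) q`_i *: X ^+ i = horner_mx X q.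
  rewrite -[in RHS](coefK q) poly_def raddf_sum /=.
  by apply: eq_bigr => i _; rewrite linearZ /= rmorphXn /= horner_mx_X.
by apply/seteqP; split=> Z [q _ <-]; exists q; rewrite ?h.
Qed.

Definition gl_regular (K : fieldType) (n : nat) (X : 'M[K]_n) : Prop :=
  centraliser X = generated_algebra X.

(* Main.v *)
Require Import Defs.
From HB Require Import structures.
From mathcomp Require Import all_boot all_order all_algebra.
From mathcomp Require Import boolp classical_sets.
From mathcomp Require Import fingroup perm zify ring.

Set Implicit Arguments.
Unset Strict Implicit.
Unset Printing Implicit Defensive.

Import GRing.Theory.

Local Open Scope classical_set_scope.
Local Open Scope ring_scope.

(** A is first conjugated to a matrix whose first row is (a, d, 0, ..., 0),
    where d generates the ideal of all off-diagonal entries and differences of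
    diagonal entries: among all off-diagonal entries of conjugates of A, one
    generating a maximal ideal divides everything.  Splitting off g = gcd(a, d)
    reduces to A = a + m B with a, m coprime and B having first row
    (0, 1, 0, ..., 0).

    For such A = (a, m e; m b, a + m B'), e = (1, 0, ..., 0), take
    X = (0, 0; u, C), C the companion matrix of t^(n-1) + m.  The powers
    1, ..., n-2 of C have trace zero, so the conditions tr(X^r A) = 0 determine
    u from B', its last entry being -a, and then [X, Y] = A can be solved
    explicitly with the top left entry of Y equal to -tr Z, where Z is the lower
    right block of Y.  Modulo a maximal ideal X is cyclic, because its
    characteristic polynomial is t^n + m t and either m or the last entry of u
    is nonzero there. *)

(** * Divisibility in principal ideal rings *)

Definition dvdr (R : comPzRingType) (a b : R) : Prop := exists c, b = c * a.

Section Divisibility.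
Variable R : comPzRingType.
Implicit Types a b c d x y : R.

Lemma dvdr_refl a : dvdr a a.
Proof. by exists 1; rewrite mul1r. Qed.

Lemma dvdr_trans b a c : dvdr a b -> dvdr b c -> dvdr a c.
Proof. by move=> [x ->] [y ->]; exists (y * x); rewrite mulrA. Qed.

Lemma dvdr0 a : dvdr a 0.
Proof. by exists 0; rewrite mul0r. Qed.

Lemma dvdr_mull c a b : dvdr a b -> dvdr a (c * b).
Proof. by move=> [x ->]; exists (c * x); rewrite mulrA. Qed.

Lemma dvdrD a b c : dvdr a b -> dvdr a c -> dvdr a (b + c).
Proof. by move=> [x ->] [y ->]; exists (x + y); rewrite mulrDl. Qed.

Lemma dvdrN a b : dvdr a b -> dvdr a (- b).
Proof. by move=> [x ->]; exists (- x); rewrite mulNr. Qed.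

Lemma dvdrB a b c : dvdr a b -> dvdr a c -> dvdr a (b - c).
Proof. by move=> ab ac; apply: dvdrD => //; apply: dvdrN. Qed.

End Divisibility.

Section PrincipalIdealRing.
Variable R : comPzRingType.
Hypothesis pirR : principal_ideal_ring R.
Implicit Types a b c d e g m x y : R.

Lemma ideal_generator (I : set R) :
  is_ideal I -> exists a, forall x, I x <-> dvdr a x.
Proof.
move=> /pirR [a ->]; exists a => x; split=> [[b _ <-]|[b ->]]; by exists b.
Qed.

Lemma bezout_gcd a b :
  exists g, [/\ dvdr g a, dvdr g b & exists x y, g = x * a + y * b].
Proof.
have [|g gP] := @ideal_generator [set z | exists x y, z = x * a + y * b].
  split.
  - by exists 0, 0; ring.
  - by move=> _ _ [x [y ->]] [z [t ->]]; exists (x + z), (y + t); ring.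
  - by move=> c _ [x [y ->]]; exists (c * x), (c * y); ring.
exists g; split; last by apply/gP; exact: dvdr_refl.
- by apply/gP; exists 1, 0; ring.
- by apply/gP; exists 0, 1; ring.
Qed.

Lemma colon_generator d g : exists m, forall x, dvdr m x <-> dvdr d (g * x).
Proof.
have [|m mP] := @ideal_generator [set x | dvdr d (g * x)].
  split=> /=.
  - by rewrite mulr0; exact: dvdr0.
  - by move=> x y dx dy; rewrite mulrDr; exact: dvdrD.
  - by move=> a x dx; rewrite mulrCA; exact: dvdr_mull.
by exists m => x; split=> /mP.
Qed.

Lemma annihilator_generator g : exists e, forall x, dvdr e x <-> g * x = 0.
Proof.
have [e eP] := colon_generator 0 g; exists e => x; split.
  by move=> /eP [c ->]; rewrite mulr0.
by move=> gx; apply/eP; rewrite gx; exact: dvdr0.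
Qed.

(** Ascending chain condition: otherwise choice yields a strictly increasing sequence of principal
    ideals, but the generator of their union already lies in one of them. *)
Lemma maximal_generator (P : R -> Prop) a0 : P a0 ->
  exists a, P a /\ forall b, P b -> dvdr b a -> dvdr a b.
Proof.
move=> Pa0; apply: contrapT => noMax.
have next (u : {a | P a}) :
    {v : {a | P a} | dvdr (sval v) (sval u) /\ ~ dvdr (sval u) (sval v)}.
  apply: cid; case: u => a Pa /=; apply: contrapT => noNext.
  apply: noMax; exists a; split=> // b Pb ba.
  by apply: contrapT => nab; apply: noNext; exists (exist _ b Pb).
pose u k := iter k (fun v => sval (next v)) (exist _ a0 Pa0).
have uS k :
    dvdr (sval (u k.+1)) (sval (u k)) /\ ~ dvdr (sval (u k)) (sval (u k.+1)).
  exact: (svalP (next (u k))).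
have u_le j k : (j <= k)%N -> dvdr (sval (u k)) (sval (u j)).
  elim: k => [|k IHk]; first by rewrite leqn0 => /eqP ->; exact: dvdr_refl.
  rewrite leq_eqVlt => /orP[/eqP ->|]; first exact: dvdr_refl.
  by rewrite ltnS => /IHk; apply: dvdr_trans; case: (uS k).
have [|c cP] := @ideal_generator [set x | exists k, dvdr (sval (u k)) x].
  split=> /=.
  - by exists 0%N; exact: dvdr0.
  - move=> x y [j jx] [k ky]; exists (maxn j k); apply: dvdrD.
      by apply: dvdr_trans jx; apply: u_le; exact: leq_maxl.
    by apply: dvdr_trans ky; apply: u_le; exact: leq_maxr.
  - by move=> a x [k kx]; exists k; exact: dvdr_mull.
have [k kc] : exists k, dvdr (sval (u k)) c by apply/cP; exact: dvdr_refl.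
have /cP ck : exists j, dvdr (sval (u j)) (sval (u k.+1)).
  by exists k.+1; exact: dvdr_refl.
by case: (uS k) => _; apply; apply: dvdr_trans ck.
Qed.

(** [mu] generates a maximal proper ideal containing [q]; if it does not divide [x], then 1 is a
    combination of [mu] and [x]. *)
Lemma prime_divisor q : ~ dvdr q 1 -> exists mu,
  [/\ dvdr mu q, ~ dvdr mu 1
    & forall x y, dvdr mu (x * y) -> dvdr mu x \/ dvdr mu y].
Proof.
move=> q1.
have [|mu [[mu1 muq] mu_max]] := @maximal_generator
    (fun b => ~ dvdr b 1 /\ dvdr b q) q; first by split=> //; exact: dvdr_refl.
exists mu; split=> // x y muxy.
have [?|nmux] := pselect (dvdr mu x); [by left | right].
have [g [gmu gx [s [t gE]]]] := bezout_gcd mu x.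
have [[c c1]|ng1] := pselect (dvdr g 1).
  rewrite -[y]mul1r c1 gE.
  have -> : c * (s * mu + t * x) * y = c * t * (x * y) + c * s * y * mu by ring.
  by apply: dvdrD; [exact: dvdr_mull | exists (c * s * y)].
case: nmux; apply: dvdr_trans gx; apply: mu_max => //.
by split=> //; apply: dvdr_trans muq.
Qed.

(** Extracting factors [mu] stops by the chain condition: at a maximal [h'], a further factor
    [h' = h'' * mu] would force [h'' = c * h'], hence [(1 - c * mu) * h = 0]. *)
Lemma pow_factor mu h : ~ (exists c, (1 - c * mu) * h = 0) ->
  exists i h', h = mu ^+ i * h' /\ ~ dvdr mu h'.
Proof.
move=> hN.
have [|h' [[i hE] h'max]] := @maximal_generator
    (fun h' => exists i, h = mu ^+ i * h') h.
  by exists 0%N; rewrite mul1r.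
exists i, h'; split=> // -[h'' h'E].
have [||c h''E] := h'max h''.
- by exists i.+1; rewrite hE h'E exprS; ring.
- by exists mu; rewrite mulrC.
apply: hN; exists c; rewrite hE h'E.
have -> : (1 - c * mu) * (mu ^+ i * (h'' * mu)) =
  mu ^+ i * mu * (h'' - c * (h'' * mu)) by ring.
by rewrite -h'E -h''E subrr mulr0.
Qed.

Lemma prime_dvdr_pow mu x k :
    ~ dvdr mu 1 -> (forall x y, dvdr mu (x * y) -> dvdr mu x \/ dvdr mu y) ->
  dvdr mu (x ^+ k) -> dvdr mu x.
Proof.
move=> mu1 muP; elim: k => [|k IHk]; first by rewrite expr0 => /mu1.
by rewrite exprS => /muP [].
Qed.

(* In the decomposition of R into principal ideal domains and local Artinian
   rings, a generator of an annihilator is 0 or a unit in the former and a unit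
   or nilpotent in the latter, so some power of it generates an idempotent
   ideal. *)
Lemma annihilator_generator_pow g e : (forall x, dvdr e x <-> g * x = 0) ->
  exists k w, e ^+ k.+1 * (1 - e ^+ k.+1 * w) = 0.
Proof.
move=> eP.
have [t1 t1P] := annihilator_generator (e ^+ 1).
(* [t] generates the annihilator of [e ^+ k.+1] at a stage where these annihilators no longer grow.
   If [t] and [e ^+ k.+1] were not comaximal, a prime [mu] would divide both. *)
have [|t [[k tP] t_max]] := @maximal_generator
    (fun t => exists k, forall x, dvdr t x <-> e ^+ k.+1 * x = 0) t1.
  by exists 0%N.
exists k; have [q [qe qt [x [y qE]]]] := bezout_gcd (e ^+ k.+1) t.
have et0 : e ^+ k.+1 * t = 0 by apply/tP; exact: dvdr_refl.
have [[c c1]|/prime_divisor [mu [muq mu1 muP]]] := pselect (dvdr q 1).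
  exists (c * x).
  have -> : 1 - e ^+ k.+1 * (c * x) = c * y * t by rewrite [in LHS]c1 qE; ring.
  by rewrite mulrCA et0 mulr0.
have mue : dvdr mu e.
  by apply: (prime_dvdr_pow mu1 muP) (dvdr_trans muq qe).
have mut : dvdr mu t := dvdr_trans muq qt.
have nmu c : ~ dvdr mu (1 - c * mu).
  move=> h; apply: mu1; rewrite -(subrK (c * mu) 1); apply: dvdrD => //.
  by exists c.
have [|i [g' [gE ng']]] := @pow_factor mu g.
  move=> [c cg]; apply: (nmu c); apply: dvdr_trans mue _.
  by apply/eP; rewrite mulrC.
have [|j [e' [eE ne']]] := @pow_factor mu e.
  move=> [c ce]; apply: (nmu c); apply: dvdr_trans mut _.
  by apply/tP; rewrite exprSr -mulrA [e * _]mulrC ce mulr0.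
have ge0 : g * e = 0 by apply/eP; exact: dvdr_refl.
(* As [mu] divides [e], the factor [e ^+ (i + j)] restores the powers of [mu] stripped from [g] and
   [e]. So [g' * e'] lies in the stable annihilator and [mu] divides it, against primality. *)
have e0 : e ^+ (i + j) * (g' * e') = 0.
  have [c cE] := mue.
  have -> : e ^+ (i + j) * (g' * e') =
      c ^+ (i + j) * ((mu ^+ i * g') * (mu ^+ j * e')).
    by rewrite {1}cE exprMn [mu ^+ (_ + _)]exprD; ring.
  by rewrite -gE -eE ge0 mulr0.
have [t' t'P] := annihilator_generator (e ^+ (k + (i + j)).+1).
have tt' : dvdr t t'.
  apply: t_max; first by exists (k + (i + j))%N.
  by apply/t'P; rewrite -addSn exprD mulrAC et0 mul0r.
have /(dvdr_trans (dvdr_trans mut tt'))/muP[//|//] : dvdr t' (g' * e').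
by apply/t'P; rewrite -addSn exprD -mulrA e0 mulr0.
Qed.

(** [E * w] is idempotent with complement [t]. Where it is 1, [e] is invertible and [x] can be moved
    to 1; on the complement [e] is nilpotent and [G] inverts [1 - c * e]. *)
Lemma annihilator_lift g e x y a b c :
    (forall z, dvdr e z <-> g * z = 0) -> 1 = a * x + b * y + c * e ->
  exists s a' b', 1 = a' * (x + s * e) + b' * y.
Proof.
move=> eP unimod.
have [k [w ew]] := annihilator_generator_pow eP.
set E := e ^+ k.+1 in ew; pose t := 1 - E * w.
have Et : E * t = 0 by [].
have tt : t * t = t by rewrite {1}/t mulrBl mul1r mulrAC Et mul0r subr0.
exists (e ^+ k * w * (1 - x)).
pose G := \sum_(i < k.+1) (c * e) ^+ i.
have GE : (1 - c * e) * G = 1 - c ^+ k.+1 * E.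
  rewrite /E -exprMn /G -[X in _ = X - _](expr1n _ k.+1) subrXX; congr (_ * _).
  by apply: eq_bigr => i _; rewrite expr1n mul1r.
have xE : x + e ^+ k * w * (1 - x) * e = E * w + t * x.
  by rewrite /t /E exprSr; ring.
rewrite xE; exists (E * w + t * G * a), (t * G * b).
have -> : (E * w + t * G * a) * (E * w + t * x) + t * G * b * y =
   (E * w) * (E * w) + (E * t) * (w * x + G * a * w) +
   t * t * (G * (a * x)) + t * (G * (b * y)).
  by ring.
rewrite Et tt.
have -> : a * x = (1 - c * e) - b * y by rewrite unimod; ring.
have -> : E * w = 1 - t by rewrite /t; ring.
have -> : (1 - t) * (1 - t) = 1 - 2%:R * t + t * t by ring.
rewrite tt.
transitivity (1 - t + t * ((1 - c * e) * G)); last by ring.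
have -> : t * ((1 - c * e) * G) = t - c ^+ k.+1 * (E * t) by rewrite GE; ring.
by rewrite Et; ring.
Qed.

(** Bezout coefficients are unimodular only modulo the annihilator of the gcd; [annihilator_lift]
    corrects them without changing the combination. *)
Lemma gcd_unimodular_comb a b : exists x y, [/\ dvdr (x * a + y * b) a,
  dvdr (x * a + y * b) b & exists x' y', x * x' + y * y' = 1].
Proof.
have [g [[a' aE] [b' bE] [x [y gE]]]] := bezout_gcd a b.
have [e eP] := annihilator_generator g.
have /eP [c cE] : g * (1 - (x * a' + y * b')) = 0.
  have -> : g * (1 - (x * a' + y * b')) = g - (x * (a' * g) + y * (b' * g)) by ring.
  by rewrite -aE -bE -gE subrr.
have unimod : 1 = a' * x + b' * y + c * e by rewrite -cE; ring.
have [s [x' [y' sE]]] := annihilator_lift eP unimod.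
have ge0 : g * e = 0 by apply/eP; exact: dvdr_refl.
have hE : (x + s * e) * a + y * b = g.
  have -> : (x + s * e) * a + y * b = x * a + y * b + s * a' * (g * e).
    by rewrite aE; ring.
  by rewrite ge0 mulr0 addr0.
exists (x + s * e), y; rewrite hE; split; [by exists a' | by exists b' |].
by exists x', y'; rewrite sE; ring.
Qed.

(** The quotient [c] is invertible modulo the annihilator of [x], and the same lift turns it into a
    unit. *)
Lemma associate_unit x y : dvdr x y -> dvdr y x ->
  exists u v, u * v = 1 /\ y = u * x.
Proof.
move=> [c yE] [c' xE].
have [e eP] := annihilator_generator x.
have /eP [r rE] : x * (1 - c' * c) = 0.
  have -> : x * (1 - c' * c) = x - c' * (c * x) by ring.
  by rewrite -yE -xE subrr.
have unimod : 1 = c' * c + 0 * 0 + r * e by rewrite -rE; ring.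
have [s [v [b vE]]] := annihilator_lift eP unimod.
exists (c + s * e), v; split; first by rewrite vE; ring.
have xe0 : x * e = 0 by apply/eP; exact: dvdr_refl.
have -> : (c + s * e) * x = c * x + s * (x * e) by ring.
by rewrite xe0 mulr0 addr0.
Qed.

End PrincipalIdealRing.

(** * Conjugation to a matrix with divisible entries *)

Definition is_conjugate (R : comPzRingType) n (A B : 'M[R]_n) : Prop :=
  exists P Q : 'M[R]_n, P *m Q = 1%:M /\ B = P *m A *m Q.

Section Conjugation.
Variables (R : comPzRingType) (n : nat).
Implicit Types (A B C : 'M[R]_n) (i j k l : 'I_n).

Lemma conjugate_refl A : is_conjugate A A.
Proof. by exists 1%:M, 1%:M; rewrite !mul1mx mulmx1. Qed.

Lemma conjugate_trans B A C : is_conjugate A B -> is_conjugate B C -> is_conjugate A C.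
Proof.
move=> [P [Q [PQ ->]]] [P' [Q' [PQ' ->]]]; exists (P' *m P), (Q *m Q').
split; last by rewrite !mulmxA.
by rewrite mulmxA -(mulmxA P') PQ mulmx1.
Qed.

Lemma conjugate_trmx A B : is_conjugate A B -> is_conjugate A^T B^T.
Proof.
move=> [P [Q [PQ ->]]]; exists Q^T, P^T.
by rewrite -trmx_mul PQ trmx1 !trmx_mul mulmxA.
Qed.

Lemma conjugate_mxtrace A B : is_conjugate A B -> \tr B = \tr A.
Proof.
move=> [P [Q [PQ ->]]]; rewrite mxtrace_mulC mulmxA (mulmx1C PQ).
by rewrite mul1mx.
Qed.

(** Conjugation by [1 + w v], whose inverse is [1 - w v] because [v w = c k = 0]. *)
Lemma conjugate_transvection A k (c : 'I_n -> R) : c k = 0 ->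
  exists B, [/\ is_conjugate A B,
    forall i l, i != k -> B i l = A i l - A i k * c l
  & forall l, B k l = A k l + \sum_h c h * A h l -
                      (A k k + \sum_h c h * A h k) * c l].
Proof.
move=> ck; pose w : 'cV[R]_n := delta_mx k 0; pose v : 'rV[R]_n := \row_h c h.
have vw : v *m w = 0.
  by rewrite /w -colE; apply/matrixP=> i j; rewrite !mxE.
pose P := 1%:M + w *m v; pose Q := 1%:M - w *m v.
have rowP i l : (P *m A) i l = A i l + (i == k)%:R * \sum_h c h * A h l.
  rewrite /P mulmxDl mul1mx mxE -mulmxA !mxE big_ord1 !mxE andbT; congr (_ + _ * _).
  by apply: eq_bigr => h _; rewrite mxE.
have colQ C i l : (C *m Q) i l = C i l - C i k * c l.
  rewrite /Q mulmxBr mulmx1 mulmxA /w -colE !mxE big_ord1 !mxE.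
  by [].
exists (P *m A *m Q); split=> [|i l /negPf ik|l].
- exists P, Q; split=> //; rewrite /P /Q mulmxDl mul1mx mulmxBr mulmx1.
  by rewrite -mulmxA [v *m _]mulmxA vw mul0mx mulmx0 subr0 subrK.
- by rewrite colQ !rowP ik !mul0r !addr0.
- by rewrite colQ !rowP eqxx !mul1r.
Qed.

(** The matrix [U] of determinant 1 with first column [(x, y)] acts on the coordinates [j] and [k];
    the left factor fixes row [i]. *)
Lemma conjugate_combine_columns A i j k x y x' y' :
    i != j -> i != k -> j != k -> x * x' + y * y' = 1 ->
  exists B, is_conjugate A B /\ B i j = x * A i j + y * A i k.
Proof.
move=> ij ik jk xy1.
pose J : 'M[R]_(n, 1 + 1) := row_mx (delta_mx j 0) (delta_mx k 0).
pose U : 'M[R]_(1 + 1) := block_mx x%:M (- y')%:M y%:M x'%:M.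
pose V : 'M[R]_(1 + 1) := block_mx x'%:M y'%:M (- y)%:M x%:M.
have JJ : J^T *m J = 1%:M.
  rewrite /J tr_row_mx !trmx_delta mul_col_row !mul_delta_mx_cond.
  rewrite !eqxx [k == j]eq_sym (negPf jk) !mulr0n !mulr1n.
  rewrite (scalar_mx_block 1 1); congr block_mx;
    by apply/matrixP=> a b; rewrite !mxE !ord1.
have VU : V *m U = 1%:M.
  rewrite /V /U mulmx_block -!scalar_mxM -!raddfD /= (scalar_mx_block 1 1).
  have -> : x' * x + y' * y = 1 by rewrite -xy1; ring.
  have -> : x' * - y' + y' * x' = 0 by ring.
  have -> : - y * x + x * y = 0 by ring.
  have -> : - y * - y' + x * x' = 1 by rewrite -xy1; ring.
  by rewrite !raddf0.
pose V1 := V - 1%:M; pose U1 := U - 1%:M.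
have VU1 : U1 + (V1 + V1 *m U1) = 0.
  rewrite /V1 /U1 mulmxBr mulmxBl mulmx1 mul1mx VU.
  by apply/matrixP=> a b; rewrite !mxE; ring.
(* [J] embeds the two coordinates, so these are [V] and [U] extended by the identity. *)
pose P := 1%:M + J *m V1 *m J^T; pose Q := 1%:M + J *m U1 *m J^T.
have PQ : P *m Q = 1%:M.
  rewrite /P mulmxDl mul1mx {2}/Q mulmxDr mulmx1.
  have -> : J *m V1 *m J^T *m (J *m U1 *m J^T) = J *m (V1 *m U1) *m J^T.
    by rewrite -!mulmxA [J^T *m (J *m _)]mulmxA JJ mul1mx.
  by rewrite /Q -addrA -!mulmxDl -!mulmxDr VU1 mulmx0 mul0mx addr0.
exists (P *m A *m Q); split; first by exists P, Q.
have rowP : row i P = row i 1%:M.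
  have J0 : row i J = 0.
    rewrite /J row_row_mx -[RHS]row_mx0; congr row_mx; apply/matrixP=> a b;
      by rewrite !mxE (negPf ij, negPf ik).
  by rewrite /P raddfD /= 2!row_mul J0 !mul0mx addr0.
have colQ : Q *m delta_mx j 0 = x *: delta_mx j 0 + y *: delta_mx k 0 :> 'cV_n.
  pose f : 'cV[R]_(1 + 1) := col_mx 1%:M 0.
  have Jf : J *m f = delta_mx j 0 by rewrite mul_row_col mulmx1 mulmx0 addr0.
  have Uf : U *m f = col_mx x%:M y%:M.
    by rewrite mul_block_col !mulmx1 !mulmx0 !addr0.
  rewrite -{1}Jf /Q mulmxDl mul1mx -!mulmxA [J^T *m (J *m f)]mulmxA JJ mul1mx.
  rewrite /U1 mulmxBl mul1mx mulmxBr addrC subrK Uf mul_row_col.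
  by rewrite !mul_mx_scalar.
have -> : (P *m A *m Q) i j = (row i (P *m A) *m (Q *m delta_mx j (0 : 'I_1)))
    0 0.
  by rewrite mulmxA -row_mul -colE !mxE.
rewrite row_mul rowP -row_mul mul1mx colQ mulmxDr -!scalemxAr -!colE !mxE.
by [].
Qed.

End Conjugation.

(** * Maximal off-diagonal entries *)

Section FirstRow.
Variables (R : comPzRingType) (n : nat).
Hypothesis pirR : principal_ideal_ring R.
Implicit Types (A B C : 'M[R]_n) (i j k l : 'I_n) (d : R).

Lemma conjugate_move_entry A i0 i1 i j : i0 != i1 -> i != j ->
  exists B, is_conjugate A B /\ B i0 i1 = A i j.
Proof.
move=> i01 ij; pose s := (tperm i i0 * tperm (tperm i i0 i1) j)%g.
exists (row_perm s (col_perm s A)); split.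
  exists (perm_mx s), (perm_mx s^-1%g).
  by rewrite -perm_mxM mulgV perm_mx1 row_permE col_permE mulmxA.
have si1 : tperm i i0 i1 != i.
  by apply: contra_neq i01 => /(canRL (tpermK _ _)); rewrite tpermL.
have ji : j != i by rewrite eq_sym.
by rewrite !mxE !permM tpermR tpermL [tperm _ j i]tpermD.
Qed.

Lemma sum_indicator (x : R) (F : 'I_n -> R) i :
  \sum_h (if h == i then x else 0) * F h = x * F i.
Proof.
rewrite (bigD1 i) //= eqxx big1 ?addr0 // => h /negPf ->.
by rewrite mul0r.
Qed.

Definition offdiag_maximal A d : Prop :=
  forall B i j, is_conjugate A B -> i != j -> dvdr (B i j) d -> dvdr d (B i j).

Lemma offdiag_maximal_conj A B d :
  is_conjugate A B -> offdiag_maximal A d -> offdiag_maximal B d.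
Proof. by move=> AB maxA C i j BC; apply: maxA; apply: conjugate_trans BC. Qed.

Lemma offdiag_maximal_trmx A d : offdiag_maximal A d -> offdiag_maximal A^T d.
Proof.
move=> maxA B i j /conjugate_trmx; rewrite trmxK => AB ij.
by have := maxA _ j i AB; rewrite mxE eq_sym; apply.
Qed.

(** The gcd of the two entries is an off-diagonal entry of a conjugate and divides [d], so by
    maximality [d] divides it. *)
Lemma offdiag_maximal_row A d i j k : offdiag_maximal A d ->
    i != j -> i != k -> j != k ->
    (exists s t, d = s * A i j + t * A i k) ->
  dvdr d (A i j) /\ dvdr d (A i k).
Proof.
move=> maxA ij ik jk [s [t dE]].
have [x [y [hj hk [x' [y' xy1]]]]] := gcd_unimodular_comb pirR (A i j) (A i k).
have [B [AB BE]] := conjugate_combine_columns A ij ik jk xy1.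
have dB : dvdr d (B i j).
  apply: maxA => //; rewrite BE dE.
  by apply: dvdrD; apply: dvdr_mull.
by split; apply: dvdr_trans dB _; rewrite BE.
Qed.

(** Keeping column [i1] away from row [i1] allows a second use, on the transpose, that leaves the
    cleared row intact. *)
Lemma offdiag_maximal_clear_row A d i0 i1 : i0 != i1 ->
    offdiag_maximal A d -> A i0 i1 = d ->
  exists B, [/\ is_conjugate A B, B i0 i1 = d,
    forall k, k != i0 -> k != i1 -> B i0 k = 0
  & forall k, k != i1 -> B k i1 = A k i1].
Proof.
move=> i01 maxA Ad.
have qP l : exists q, l != i0 -> l != i1 -> A i0 l = q * d.
  have [/andP[l0 l1]|lN] := boolP ((l != i0) && (l != i1)); last first.
    by exists 0 => l0 l1; rewrite l0 l1 in lN.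
  rewrite eq_sym in l0; rewrite eq_sym in l1.
  have [|_ [q qE]] := offdiag_maximal_row maxA i01 l0 l1; last by exists q.
  by exists 1, 0; rewrite Ad; ring.
have [q qE] := choice qP.
pose c l := if (l != i0) && (l != i1) then q l else 0.
have [|B [AB BE _]] := @conjugate_transvection R n A i1 c.
  by rewrite /c eqxx andbF.
exists B; split=> //.
- by rewrite BE // /c eqxx andbF mulr0 subr0.
- by move=> k k0 k1; rewrite BE // Ad /c k0 k1 /= qE // mulrC subrr.
- by move=> k k1; rewrite BE // /c eqxx andbF mulr0 subr0.
Qed.

Lemma offdiag_maximal_dvd_left A d i0 i1 k :
    offdiag_maximal A d -> A i0 i1 = d ->
    (forall l, l != i0 -> l != i1 -> A i0 l = 0 /\ A l i1 = 0) ->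
    i0 != i1 -> k != i0 -> k != i1 ->
  [/\ dvdr d (A k i0), dvdr d (A k k - A i0 i0)
    & forall l, l != i0 -> l != i1 -> l != k -> dvdr d (A k l)].
Proof.
move=> maxA Ad A0 i01 k0 k1.
have [A0k Ak1] := A0 k k0 k1.
have [i0k i1k] : i0 != k /\ i1 != k by rewrite ![_ == k]eq_sym.
(* Adding row [k] to row [i0] brings its entries beside [d], where [offdiag_maximal_row] applies;
   only [A k i0] then remains. *)
have [|B [AB _ BE]] := @conjugate_transvection R n A i0
    (fun h => if h == k then 1 else 0).
  by rewrite (negPf i0k).
have Bd : B i0 i1 = d.
  by rewrite BE !sum_indicator (negPf i1k) Ad Ak1; ring.
have maxB := offdiag_maximal_conj AB maxA.
have dB l : l != i0 -> l != i1 -> dvdr d (B i0 l).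
  move=> l0 l1; apply: (proj2 (offdiag_maximal_row maxB i01 _ _ _));
    rewrite 1?eq_sym //.
  by exists 1, 0; rewrite Bd; ring.
have dA l : l != i0 -> l != i1 -> l != k -> dvdr d (A k l).
  move=> l0 l1 lk; have := dB l l0 l1.
  rewrite BE !sum_indicator (negPf lk) (proj1 (A0 l l0 l1)).
  by rewrite mulr0 subr0 add0r mul1r.
have [e eE] : dvdr d (A k k - A i0 i0 - A k i0).
  have := dB k k0 k1; rewrite BE !sum_indicator eqxx A0k.
  by have -> : 0 + 1 * A k k - (A i0 i0 + 1 * A k i0) * 1 =
    A k k - A i0 i0 - A k i0 by ring.
suff dk0 : dvdr d (A k i0).
  split=> //; rewrite -(subrK (A k i0) (_ - A i0 i0)).
  by apply: dvdrD => //; exists e.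
have [h [[r1 rE] [d1 dE] [z [y hE]]]] := bezout_gcd pirR (A k i0) d.
(* Since 1 - x = z r1 modulo the annihilator of h, the entries (k, i0) and
   (k, i1) of the is_conjugate below generate the same ideal as r1^2 z h and
   d1^2 y h, hence the ideal (h), because z r1 + y d1 = 1 modulo that
   annihilator. *)
pose x := y * d1.
have [|C [AC _ CE]] := @conjugate_transvection R n A k
    (fun h => if h == i0 then x else 0).
  by rewrite (negPf k0).
have maxC := offdiag_maximal_conj AC maxA.
have Ck0 : C k i0 + e * (x * d) = A k i0 * (1 - x).
  rewrite CE !sum_indicator eqxx A0k.
  have -> : A k k = e * d + A i0 i0 + A k i0 by rewrite -eE; ring.
  by ring.
have Ck1 : C k i1 = x * d.
  rewrite CE !sum_indicator eq_sym (negPf i01) Ak1 Ad; ring.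
have hq : h = (z * r1 + y * d1) * h by rewrite mulrDl -!mulrA -rE -dE.
have hx : h * (1 - x) = h * z * r1.
  have -> : h * (1 - x) = h - (z * r1 + y * d1) * h + h * z * r1.
    by rewrite /x; ring.
  by rewrite -hq subrr add0r.
(* [s] and [t] come from expanding the cube of [z * r1 + y * d1], which fixes [h]: two terms contain
   [z * r1 ^+ 2], the other two [y * d1 ^+ 2]. *)
pose s := z * z * r1 + 3%:R * z * y * d1.
pose t := 3%:R * z * r1 * y + y * y * d1.
have hC : h = s * (A k i0 * (1 - x)) + t * (x * d).
  have -> : A k i0 * (1 - x) = r1 * (h * z * r1) by rewrite -hx {1}rE; ring.
  rewrite {1}hq {1}hq {1}hq /s /t /x [in y * d1 * d]dE; ring.
have dh : dvdr d h.
  have [|dC0 dC1] := offdiag_maximal_row maxC k0 k1 i01.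
    rewrite dE {1}hC -Ck0 -Ck1.
    by exists (d1 * s), (d1 * (s * e + t)); ring.
  rewrite hC -Ck0 -Ck1; apply: dvdrD; apply: dvdr_mull => //.
  by apply: dvdrD => //; apply: dvdr_mull.
by rewrite rE; apply: dvdr_mull.
Qed.

Lemma conjugate_first_row A i0 i1 i2 : i0 != i1 -> i2 != i0 -> i2 != i1 ->
  exists B d, [/\ is_conjugate A B, B i0 i1 = d,
    forall k, k != i0 -> k != i1 -> B i0 k = 0,
    forall k l, k != l -> dvdr d (B k l)
  & forall k, dvdr d (B k k - B i0 i0)].
Proof.
move=> i01 i20 i21; have i10 : i1 != i0 by rewrite eq_sym.
have [|d [[A1 [AA1 A1d]] d_max]] := @maximal_generator R pirR
    (fun d => exists B, is_conjugate A B /\ B i0 i1 = d) (A i0 i1).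
  by exists A; split=> //; exact: conjugate_refl.
have max1 : offdiag_maximal A1 d.
  move=> B i j AB ij; apply: d_max.
  have [C [BC <-]] := conjugate_move_entry B i01 ij; exists C; split=> //.
  by apply: conjugate_trans BC; apply: conjugate_trans AB.
have [A2 [A12 A2d A2row _]] := offdiag_maximal_clear_row i01 max1 A1d.
have max2 := offdiag_maximal_conj A12 max1.
have [|D [A23 A3d A3row A3col]] :=
    offdiag_maximal_clear_row i10 (offdiag_maximal_trmx max2).
  by rewrite mxE; exact: A2d.
pose A3 := D^T; have {}A23 : is_conjugate A2 A3.
  by rewrite -[A2]trmxK; exact: conjugate_trmx.
have max3 := offdiag_maximal_conj A23 max2.
have {}A3d : A3 i0 i1 = d by rewrite mxE.
have A30 l : l != i0 -> l != i1 -> A3 i0 l = 0 /\ A3 l i1 = 0.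
  by move=> l0 l1; rewrite !mxE A3row // A3col // mxE A2row.
clearbody A3.
have dl k := offdiag_maximal_dvd_left max3 A3d A30 i01 (k := k).
(* Transposition exchanges [i0] and [i1]. The index [i2] then compares their diagonal entries; the
   entry [(i1, i0)], reached from neither side, comes last. *)
have dr k (k0 : k != i0) (k1 : k != i1) :
    dvdr d (A3 i1 k) /\ dvdr d (A3 k k - A3 i1 i1).
  have [|l l1 l0|] := offdiag_maximal_dvd_left (offdiag_maximal_trmx max3)
    _ _ i10 k1 k0; [by rewrite mxE | by rewrite !mxE; case: (A30 l l0 l1) |].
  by rewrite !mxE.
have [dl2 dd2 _] := dl i2 i20 i21.
have [[b bE] dd2'] := dr i2 i20 i21.
have [a aE] : dvdr d (A3 i1 i1 - A3 i2 i2) by rewrite -opprB; apply: dvdrN.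
have dd1 : dvdr d (A3 i1 i1 - A3 i0 i0).
  by rewrite -(subrKA (A3 i2 i2)); apply: dvdrD => //; exists a.
have d10 : dvdr d (A3 i1 i0).
  (* the multiplier of row i0 makes the entry (i2, i1) of the is_conjugate equal
     to d *)
  pose x := 1 - a + b.
  have [|C [AC _ CE]] := @conjugate_transvection R n A3 i2
      (fun h => (if h == i0 then x else 0) + (if h == i1 then 1 else 0)).
    by rewrite (negPf i20) (negPf i21) addr0.
  have sumE F : \sum_h ((if h == i0 then x else 0) +
      (if h == i1 then 1 else 0)) * F h = x * F i0 + F i1.
    under eq_bigr do rewrite mulrDl.
    by rewrite big_split /= !sum_indicator mul1r.
  have [A302 A321] := A30 i2 i20 i21.
  have C1 : C i2 i1 = d.
    rewrite CE !sumE eqxx (negPf i10) A3d A321 A302 bE.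
    have -> : A3 i1 i1 = a * d + A3 i2 i2 by rewrite -aE subrK.
    by rewrite /x; ring.
  have [|dC _] := offdiag_maximal_row (offdiag_maximal_conj AC max3) i20 i21 i01.
    by exists 0, 1; rewrite C1; ring.
  have -> : A3 i1 i0 =
      C i2 i0 - A3 i2 i0 + x * (A3 i2 i2 - A3 i0 i0) + x * A3 i1 i2.
    by rewrite CE !sumE eqxx (negPf i01) A302; ring.
  apply: dvdrD; last by apply: dvdr_mull; exists b.
  by apply: dvdrD; [exact: dvdrB | exact: dvdr_mull].
exists A3, d; split=> //.
- by apply: conjugate_trans A23; apply: conjugate_trans A12.
- by move=> k k0 k1; case: (A30 k k0 k1).
- move=> k l kl; have [k0|k0] := eqVneq k i0.
    rewrite k0 in kl *; have [->|l1] := eqVneq l i1.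
      by rewrite A3d; exact: dvdr_refl.
    by have [|-> _] := A30 l _ l1; [rewrite eq_sym | exact: dvdr0].
  have [k1|k1] := eqVneq k i1.
    rewrite k1 in kl *; have [-> //|l0] := eqVneq l i0.
    by have [|] := dr l l0; first by rewrite eq_sym.
  have [dk0 _ dkl] := dl k k0 k1.
  have [-> //|l0] := eqVneq l i0; have [->|l1] := eqVneq l i1.
    by have [_ ->] := A30 k k0 k1; exact: dvdr0.
  by apply: dkl => //; rewrite eq_sym.
- move=> k; have [->|k0] := eqVneq k i0; first by rewrite subrr; exact: dvdr0.
  have [-> //|k1] := eqVneq k i1.
  by have [] := dl k k0 k1.
Qed.

End FirstRow.

(** * Commutators with an extension of a companion matrix *)

Section Companion.
Variables (R : comPzRingType) (n : nat) (m : R).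
Local Notation N := n.+2.

(* companion matrix of t ^ N + m *)
Definition companion : 'M[R]_N :=
  \matrix_(i, j) if i == ord_max then - m * (j == 0)%:R else (j == i.+1 :> nat)%:R.

Lemma companion_mul p (M : 'M[R]_(N, p)) i j :
  (companion *m M) i j =
  if i == ord_max then - m * M 0 j else M (inord i.+1) j.
Proof.
rewrite mxE; case: eqP => [->|iN].
  rewrite (bigD1 0) //= !mxE !eqxx mulr1 big1 ?addr0 // => k /negPf k0.
  by rewrite mxE eqxx k0 mulr0 mul0r.
have iS : (i.+1 < N)%N.
  by rewrite ltn_neqAle ltn_ord andbT; apply/eqP => -[e]; apply/iN/val_inj.
move/eqP/negPf: iN => iN.
rewrite (bigD1 (inord i.+1)) //= !mxE iN inordK // eqxx mul1r big1 ?addr0 // => k ki.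
rewrite mxE iN; case: eqP => [e|_]; last by rewrite mul0r.
by case/eqP: ki; apply/val_inj; rewrite /= inordK.
Qed.

(** For [r <= N] an index wraps around at most once, hence at most one factor [- m]. *)
Lemma companion_pow r i j : (r <= N)%N ->
  (companion ^+ r) i j =
  if (i + r < N)%N then (j == i + r :> nat)%N%:R
  else - m * (j == i + r - N :> nat)%N%:R.
Proof.
elim: r i => [|r IHr] i rN.
  by rewrite expr0 addn0 ltn_ord mxE eq_sym.
rewrite exprS companion_mul; case: eqP => [->|iN].
  rewrite (IHr _ (ltnW rN)) [nat_of_ord 0]/= add0n rN.
  have -> : (@ord_max n.+1 + r.+1 = r + N)%N by rewrite /=; lia.
  by rewrite ltnNge leq_addl addnK.
have iS : (i.+1 < N)%N.
  by rewrite ltn_neqAle ltn_ord andbT; apply/eqP => -[e]; apply/iN/val_inj.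
by rewrite (IHr _ (ltnW rN)) inordK // addSnnS.
Qed.

Lemma companion_pow_trace r : (0 < r < N)%N -> \tr (companion ^+ r) = 0.
Proof.
move=> /andP[r0 rN]; rewrite /mxtrace big1 // => i _.
rewrite (companion_pow _ _ (ltnW rN)); case: ifP => h.
  by rewrite (_ : (_ == _) = false) //; lia.
by rewrite (_ : (_ == _) = false) ?mulr0 //; lia.
Qed.

(* ad C is onto the matrices orthogonal to all powers of the companion matrix C:
   [C, Z] = D can be solved row by row up to an error in the last row, which is
   detected by the traces. *)
Lemma companion_commutator (D : 'M[R]_N) :
    (forall r, (r < N)%N -> \tr (companion ^+ r *m D) = 0) ->
  exists Z, companion *m Z - Z *m companion = D.
Proof.
move=> trD.
(* Row [k] of [companion *m Z] is row [k.+1] of [Z], so each row of the equation determines the next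
   row of [Z], starting from 0. *)
pose z := fix z k := if k is k'.+1 then row (inord k') D + z k' *m companion
                     else 0 : 'rV[R]_N.
pose Z : 'M_N := \matrix_i z i; exists Z.
pose E := companion *m Z - Z *m companion - D.
have rowE i : i != ord_max -> forall j, E i j = 0.
  move=> iN j; rewrite [LHS]mxE [X in X + _]mxE ![fun_of_matrix (- _) _ _]mxE.
  rewrite companion_mul (negPf iN).
  have iS : (i.+1 < N)%N.
    rewrite ltn_neqAle ltn_ord andbT; apply: contraNneq iN => -[e].
    exact/eqP/val_inj.
  have -> : Z (inord i.+1) j = D i j + (Z *m companion) i j.
    rewrite mxE inordK //= inord_val mxE [row i D _ _]mxE; congr (_ + _).
    by rewrite !mxE; apply: eq_bigr => k _; rewrite !mxE.
  by rewrite mxE; ring.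
have trE r : (r < N)%N -> \tr (companion ^+ r *m E) = 0.
  move=> rN; rewrite /E !mulmxBr !raddfB /= trD // subr0 mulmxA.
  have -> : companion ^+ r *m companion = companion *m companion ^+ r.
    by rewrite -[LHS]exprSr -[RHS]exprS.
  by rewrite [in X in _ - X]mulmxA [in X in _ - X]mxtrace_mulC mulmxA subrr.
suff E0 : E = 0 by apply/eqP; rewrite -subr_eq0 -/E E0.
apply/matrixP=> i j; rewrite [RHS]mxE.
have [->|/rowE ->//] := eqVneq i ord_max.
(* For this exponent the last column of the power is the unit vector at [j], so the trace equals
   [E ord_max j]. *)
have rN : (n.+1 - j < N)%N by rewrite ltnS leq_subr.
rewrite -(trE _ rN) /mxtrace.
under eq_bigr => k _.
  rewrite mxE (bigD1 ord_max) //= big1 ?addr0; last first.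
    by move=> l lN; rewrite rowE // mulr0.
  over.
have jN : (j <= n.+1)%N by rewrite -ltnS.
rewrite (bigD1 j) //= (companion_pow _ _ (ltnW rN)) subnKC // ltnSn eqxx mul1r.
rewrite big1 ?addr0 // => k kj; rewrite (companion_pow _ _ (ltnW rN)).
case: ifP => h.
  rewrite (_ : (_ == _) = false) ?mul0r //; apply: contraNF kj => /eqP /= e.
  by apply/eqP/val_inj/eqP; rewrite /= -(eqn_add2r (n.+1 - j)) -e subnKC.
rewrite (_ : (_ == _) = false) ?mulr0 ?mul0r //=; move: (ltn_ord k) => /=; lia.
Qed.

End Companion.

(** * Solving the commutator equation for the normal form *)

Section ExplicitCommutator.
Variables (R : comPzRingType) (n : nat) (a m : R).
Local Notation N := n.+2.
Variables (B : 'M[R]_N) (b : 'cV[R]_N).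
Local Notation C := (companion n m).

Definition companion_extension (u : 'cV[R]_N) : 'M[R]_(1 + N) :=
  block_mx 0 0 u C.

(* The first N - 1 entries of u are forced by the equations tr(X^r A) = 0, and
   the last one by tr A = 0. *)
Definition extension_column : 'cV[R]_N :=
  \col_i if i == ord_max then - a else - \tr (C ^+ i.+1 *m B).

Local Notation u := extension_column.
Local Notation eps := (delta_mx 0 ord_max : 'rV[R]_N).

(** For [Y] with blocks [y], [eps], [c], [Z], what remains is [[C, Z] = D] and
    [C c = m b + Z u - y u]. The last entry of [C c] is a multiple of [m]; the choice [y = - \tr Z]
    cancels the terms in [a] there and also makes [Y] traceless. *)
Lemma explicit_commutator : a *+ N.+1 + m * \tr B = 0 ->
  exists Y, \tr Y = 0 /\
    companion_extension u *m Y - Y *m companion_extension u =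
    block_mx a%:M (m *: delta_mx 0 0) (m *: b) (a%:M + m *: B).
Proof.
move=> trA; pose D := a%:M + m *: B - u *m eps.
have tr_u_eps M : \tr (M *m (u *m eps)) = (M *m u) ord_max 0.
  by rewrite mulmxA mxtrace_mulC -rowE /mxtrace big_ord1 mxE.
(* For [r = 0] this is the trace hypothesis; for [r > 0] the last entry of [C ^+ r *m u] is [- m]
   times entry [r - 1] of [u]. *)
have trD r : (r < N)%N -> \tr (C ^+ r *m D) = 0.
  move=> rN; rewrite /D mulmxBr mulmxDr !raddfB raddfD /= tr_u_eps.
  rewrite mul_mx_scalar -scalemxAr !mxtraceZ.
  case: r rN => [|r] rN.
    rewrite expr0 mul1mx mul1mx [u _ _]mxE eqxx mxtrace1 -trA -mulr_natr -natr1.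
    by ring.
  rewrite companion_pow_trace // mulr0 add0r mxE.
  have rN' : (r < N)%N := ltnW rN.
  rewrite (bigD1 (Ordinal rN')) //= big1 ?addr0; last first.
    move=> k /negPf kr; rewrite (companion_pow _ _ _ (ltnW rN)) /= ltnNge.
    rewrite (_ : (N <= _)%N) /=; last by lia.
    rewrite (_ : (_ == _) = false) ?mulr0 ?mul0r //.
    by apply: contraFF kr => /eqP e; apply/eqP/val_inj; rewrite /= e; lia.
  rewrite (companion_pow _ _ _ (ltnW rN)) /= ltnNge.
  rewrite (_ : (N <= _)%N) /=; last by lia.
  rewrite (_ : (_ == _) = true); last by lia.
  rewrite mxE (_ : (_ == _) = false) /=; first by ring.
  by apply/negbTE/eqP => /(congr1 val) /=; lia.
have [Z ZD] := companion_commutator trD.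
have trZD : \tr (Z *m D) = 0.
  rewrite -ZD mulmxBr raddfB /= mulmxA.
  by rewrite [in X in X - _]mxtrace_mulC subrr.
have Zu : (Z *m u) ord_max 0 = a * \tr Z + m * \tr (Z *m B).
  rewrite -tr_u_eps.
  have -> : u *m eps = a%:M + m *: B - D by rewrite /D opprB addrC subrK.
  rewrite mulmxBr mulmxDr raddfB raddfD /= trZD subr0 mul_mx_scalar -scalemxAr.
  by rewrite !mxtraceZ.
pose k := m *: b + Z *m u + \tr Z *: u.
have kE i : k i 0 = m * b i 0 + (Z *m u) i 0 + \tr Z * u i 0.
  rewrite /k [LHS]mxE [(m *: b + Z *m u) i 0]mxE [(m *: b) i 0]mxE.
  by rewrite [(\tr Z *: u) i 0]mxE.
pose c : 'cV[R]_N := \col_i if i == 0 then - (b ord_max 0 + \tr (Z *m B))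
                            else k (inord i.-1) 0.
have Cc : C *m c = k.
  apply/matrixP=> i j; rewrite !ord1 companion_mul; case: eqP => [->|/eqP iN].
    by rewrite mxE eqxx kE Zu [u _ _]mxE eqxx; ring.
  have iS : (i.+1 < N)%N.
    rewrite ltn_neqAle ltn_ord andbT; apply: contraNneq iN => -[e].
    exact/eqP/val_inj.
  rewrite mxE inordK //= inord_val (_ : (_ == _) = false) //.
  by apply/negbTE/eqP => /(congr1 val) /=; rewrite inordK.
exists (block_mx (- \tr Z)%:M eps c Z); split.
  by rewrite mxtrace_block mxtrace_scalar mulr1n addNr.
rewrite /companion_extension !mulmx_block !mul0mx !mulmx0 !addr0 !add0r.
rewrite opp_block_mx add_block_mx; congr block_mx.
- apply/matrixP=> i j; rewrite !ord1 -rowE !mxE !eqxx.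
  by rewrite mulr1n sub0r opprK.
- rewrite sub0r -rowE; apply/matrixP=> i j; rewrite !ord1 !mxE !eqxx.
  by rewrite mulNr opprK.
- rewrite Cc /k mul_mx_scalar; apply/matrixP=> i j; rewrite !mxE; ring.
- rewrite -addrA [C *m Z - _]ZD /D; apply/matrixP=> i j; rewrite !mxE; ring.
Qed.

Lemma companion_extension_trace v : \tr (companion_extension v) = 0.
Proof.
rewrite mxtrace_block raddf0 add0r -[C]expr1; exact: companion_pow_trace.
Qed.

End ExplicitCommutator.

Lemma map_companion_extension (R S : comPzRingType) (f : {rmorphism R -> S})
    n m u :
  map_mx f (companion_extension m u) =
  companion_extension (f m) (map_mx f u) :> 'M_(1 + n.+2).
Proof.
rewrite map_block_mx !raddf0; congr block_mx.
apply/matrixP=> i j; rewrite !mxE; case: ifP => _; last exact: rmorph_nat.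
by rewrite rmorphM rmorphN rmorph_nat.
Qed.

(** * Regularity over a field *)

Section Regular.
Variable K : fieldType.

(** The rows [v *m X ^+ i] form an invertible [V], so [v *m Z = v *m q(X)] for some [q]; as [Z] and
    [q(X)] commute with [X], they agree on every row of [V]. *)
Lemma cyclic_gl_regular n (X : 'M[K]_n.+1) (v : 'rV[K]_n.+1) :
    (forall w : 'cV[K]_n.+1,
      (forall i, (i <= n)%N -> v *m X ^+ i *m w = 0) -> w = 0) ->
  gl_regular X.
Proof.
move=> cyc; rewrite /gl_regular generated_algebraE; apply/seteqP; split=> Z; last first.
  by move=> [q _ <-]; exact/comm_mx_sym/comm_mx_horner.
move=> ZX; pose V : 'M[K]_n.+1 := \matrix_i (v *m X ^+ i).
have Vu : V \in unitmx.
  rewrite -unitmx_tr -row_free_unit; apply: inj_row_free => w wV.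
  apply: trmx_inj; rewrite trmx0; apply: cyc => i iN.
  have : V *m w^T = 0 by apply: trmx_inj; rewrite trmx_mul trmxK wV trmx0.
  move=> /(congr1 (row (Ordinal (iN : (i < n.+1)%N)))).
  by rewrite row_mul rowK row0.
pose c := v *m Z *m invmx V; pose q : {poly K} := \sum_i c 0 i *: 'X^i.
have qE : horner_mx X q = \sum_i c 0 i *: X ^+ i.
  rewrite raddf_sum /=; apply: eq_bigr => i _.
  by rewrite linearZ /= rmorphXn /= horner_mx_X.
have vq : v *m horner_mx X q = v *m Z.
  rewrite -[v *m Z](mulmxKV Vu) -/c [RHS]mulmx_sum_row qE mulmx_sumr.
  by apply: eq_bigr => i _; rewrite rowK scalemxAr.
exists q => //; apply: (can_inj (mulKmx Vu)); apply/row_matrixP=> i.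
rewrite !row_mul rowK -!mulmxA.
have comX M : comm_mx M X -> X ^+ i *m M = M *m X ^+ i.
  by move=> MX; apply/esym; exact: (commrX i MX).
rewrite !comX // ?mulmxA ?vq //.
by apply/comm_mx_sym/comm_mx_horner.
Qed.

Lemma gl_regular_conj n (P Q X : 'M[K]_n.+1) : P *m Q = 1%:M ->
  gl_regular X -> gl_regular (P *m X *m Q).
Proof.
move=> PQ; have QP := mulmx1C PQ.
rewrite /gl_regular !generated_algebraE => regX.
apply/seteqP; split=> Z; last first.
  by move=> [q _ <-]; exact/comm_mx_sym/comm_mx_horner.
move=> ZX; have : Defs.centraliser X (Q *m Z *m P).
  rewrite /Defs.centraliser /= /comm_mx.
  have := congr1 (fun M => Q *m M *m P) ZX.
  rewrite !mulmxA QP mul1mx.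
  by rewrite -(mulmxA _ Q P) QP mulmx1 => <-.
rewrite regX => -[q _ qE]; exists q => //.
have ZE : Z = P *m horner_mx X q *m Q.
  by rewrite qE !mulmxA PQ mul1mx -mulmxA PQ mulmx1.
rewrite ZE; elim/poly_ind: q {qE ZE} => [|q c IHq].
  by rewrite !rmorph0 mulmx0 mul0mx.
rewrite !rmorphD !rmorphM /= !horner_mx_X !horner_mx_C IHq -!mulmxE.
rewrite mulmxDr mulmxDl !mulmxA -(mulmxA _ Q P) QP mulmx1; congr (_ + _).
by rewrite scalar_mxC -mulmxA PQ mulmx1.
Qed.

Lemma companion_extension_regular n (m : K) (u : 'cV[K]_n.+2) :
  u ord_max 0 != 0 \/ m != 0 -> gl_regular (companion_extension m u).
Proof.
(* The orthogonality conditions for [v = (c, e0)] reduce to [(u ord_max 0 + m * c) * w0 = 0], so [c]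
   is chosen to make this factor nonzero. *)
move=> um; have [c cP] : exists c, u ord_max 0 + m * c != 0.
  have [u0|u0] := eqVneq (u ord_max 0) 0; last by exists 0; rewrite mulr0 addr0.
  by exists 1; rewrite u0 add0r mulr1; case: um; rewrite ?u0 ?eqxx.
pose e0 : 'rV[K]_n.+2 := delta_mx 0 0.
pose v : 'rV[K]_(1 + n.+2) := row_mx c%:M e0.
apply: (@cyclic_gl_regular _ _ v) => w cyc.
pose w0 : 'cV[K]_1 := @usubmx _ 1 n.+2 1 w.
pose w1 : 'cV[K]_n.+2 := @dsubmx _ 1 n.+2 1 w.
have wE : w = col_mx w0 w1 by rewrite vsubmxK.
pose C := companion n m.
have vX i : v *m companion_extension m u ^+ i.+1 =
    row_mx (e0 *m C ^+ i *m u) (e0 *m C ^+ i.+1) :> 'rV_(1 + n.+2).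
  elim: i => [|i IHi].
    by rewrite !expr1 mul_row_block !mulmx0 !add0r expr0 mulmx1.
  rewrite exprSr mulmxA IHi mul_row_block !mulmx0 !add0r.
  by rewrite [C ^+ i.+2]exprSr -mulmxE mulmxA.
have e0C i : (i < n.+2)%N -> e0 *m C ^+ i = delta_mx 0 (inord i).
  move=> iN; rewrite -rowE; apply/matrixP=> k j.
  rewrite !ord1 !mxE (companion_pow _ _ _ (ltnW iN)) /= iN /=.
  by rewrite -val_eqE /= inordK.
have e0CN : e0 *m C ^+ n.+2 = - m *: e0.
  rewrite -rowE; apply/matrixP=> k j.
  rewrite !ord1 [LHS]mxE companion_pow // [nat_of_ord 0]/= add0n ltnn subnn.
  by rewrite !mxE.
have w10 : w1 0 0 = - c * w0 0 0.
  have := cyc 0 isT.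
  rewrite expr0 mulmx1 wE /v (@mul_row_col _ 1 1 n.+2 1) mul_scalar_mx -rowE.
  move=> /matrixP/(_ 0 0); rewrite !mxE => /eqP.
  by rewrite addrC addr_eq0 mulNr => /eqP.
have uw i : (i < n.+2)%N ->
    u (inord i) 0 * w0 0 0 + (e0 *m C ^+ i.+1 *m w1) 0 0 = 0.
  move=> iN; have := cyc i.+1 iN.
  rewrite vX wE (@mul_row_col _ 1 1 n.+2 1) e0C // -rowE.
  move=> /matrixP/(_ 0 0); rewrite mxE [X in X + _]mxE big_ord1 mxE => ->.
  by rewrite mxE.
have ew j : ((delta_mx 0 j : 'rV_n.+2) *m w1) 0 0 = w1 j 0 by rewrite -rowE mxE.
have w00 : w0 0 0 = 0.
  have := uw n.+1 (ltnSn _).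
  rewrite e0CN -scalemxAl [fun_of_matrix (- m *: (e0 *m w1)) 0 0]mxE ew w10.
  rewrite (_ : inord n.+1 = ord_max); last by apply/val_inj; rewrite /= inordK.
  have -> : u ord_max 0 * w0 0 0 + - m * (- c * w0 0 0) =
    (u ord_max 0 + m * c) * w0 0 0 by ring.
  by move=> /eqP; rewrite mulf_eq0 (negPf cP) => /eqP.
rewrite wE; have -> : w0 = 0 by apply/matrixP=> i j; rewrite !ord1 w00 mxE.
suff -> : w1 = 0 by rewrite col_mx0.
apply/matrixP=> i j; rewrite !ord1 [RHS]mxE.
case: (posnP i) => [i0|i0].
  by rewrite (_ : i = 0) ?w10 ?w00 ?mulr0 //; apply: val_inj.
have iN : (i.-1 < n.+2)%N by rewrite (leq_ltn_trans (leq_pred _)).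
have := uw _ iN; rewrite w00 mulr0 add0r prednK // e0C // ew.
by rewrite inord_val.
Qed.

End Regular.

(** * Reduction to the normal form and conclusion *)

Section NormalForm.
Variable R : comPzRingType.
Hypothesis pirR : principal_ideal_ring R.

(** [m] is taken to generate the colon ideal of [d] by [g], which contains the annihilator of [g];
    the Bezout relation, valid modulo that annihilator, is then repaired by a multiple of [m]. *)
Lemma gcd_colon_decomposition (a d : R) : exists g a' m,
  [/\ a = g * a', d = g * m, forall z, g * z = 0 -> dvdr m z
    & exists x y, 1 = x * a' + y * m].
Proof.
have [g [[a' aE] [d' dE] [x [y gE]]]] := bezout_gcd pirR a d.
have [m0 m0P] := colon_generator pirR d g.
have [||w [w' [ww' dw]]] := @associate_unit R pirR (g * m0) d.
- have /m0P [c cE] : dvdr d (g * d') by rewrite dE mulrC; exact: dvdr_refl.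
  by exists c; rewrite dE cE; ring.
- by apply/m0P; exact: dvdr_refl.
have mP z : g * z = 0 -> dvdr (w * m0) z.
  move=> gz; have /m0P [c ->] : dvdr d (g * z) by rewrite gz; exact: dvdr0.
  exists (c * w').
  have -> : c * w' * (w * m0) = w * w' * (c * m0) by ring.
  by rewrite ww' mul1r.
have dgm : d = g * (w * m0) by rewrite dw; ring.
exists g, a', (w * m0); split=> //; first by rewrite aE mulrC.
have /mP [c cE] : g * (1 - (x * a' + y * (w * m0))) = 0.
  transitivity (g - (x * (a' * g) + y * (g * (w * m0)))); first by ring.
  by rewrite -aE -dgm -gE subrr.
exists x, (y + c); rewrite mulrDl addrA -cE; ring.
Qed.

Lemma conjugate_normal_form n (A : 'M[R]_(1 + n.+2)) : \tr A = 0 ->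
  exists g a m (B : 'M[R]_n.+2) (b : 'cV[R]_n.+2),
    [/\ is_conjugate A (g *: block_mx a%:M (m *: delta_mx 0 0) (m *: b)
                                   (a%:M + m *: B)),
        a *+ n.+3 + m * \tr B = 0
      & exists x y, 1 = x * a + y * m].
Proof.
move=> trA.
pose i0 : 'I_(1 + n.+2) := lshift _ 0; pose i1 : 'I_(1 + n.+2) := rshift 1 0.
have [||| M [d [AM Md M0 Moff Mdiag]]] :=
    @conjugate_first_row R _ pirR A i0 i1 (rshift 1 ord_max) => //.
have [g [a [m [aE dE gm xy]]]] := gcd_colon_decomposition (M i0 i0) d.
have qP (ij : 'I_(1 + n.+2) * 'I_(1 + n.+2)) :
    exists q, M ij.1 ij.2 = M i0 i0 *+ (ij.1 == ij.2) + d * q.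
  case: ij => i j /=; have [<-|ij] := eqVneq i j.
    by have [q qE] := Mdiag i; exists q; rewrite mulr1n mulrC -qE addrC subrK.
  by have [q qE] := Moff i j ij; exists q; rewrite mulr0n add0r mulrC.
have [q qE] := choice qP.
pose B0 : 'M[R]_n.+2 := \matrix_(i, j) q (rshift 1 i, rshift 1 j).
pose b : 'cV[R]_n.+2 := \col_i q (rshift 1 i, i0).
have gz : g * (a *+ n.+3 + m * \tr B0) = 0.
  rewrite -trA -(conjugate_mxtrace AM) /mxtrace big_split_ord /= big_ord1.
  have -> : \sum_(i < n.+2) M (rshift 1 i) (rshift 1 i) =
      \sum_(i < n.+2) (M i0 i0 + d * B0 i i).
    by apply: eq_bigr => i _; rewrite (qE (_, _)) /= eqxx mxE.
  rewrite big_split /= sumr_const card_ord -mulr_sumr addrA -mulrS.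
  by rewrite aE dE mulrDr mulrnAr mulrA.
(* The trace relation so far holds only after multiplication by [g]. Its error [k * m] is killed by
   [g], so changing one diagonal entry of [B0] by [k] repairs it without altering the matrix. *)
have [k kE] := gm _ gz; pose B := B0 - k *: delta_mx 0 0.
have dk : g * m * k = 0.
  by rewrite -mulrA [m * k]mulrC -kE gz.
exists g, a, m, B, b; split=> //.
  suff <- : M = g *: block_mx a%:M (m *: delta_mx 0 0) (m *: b) (a%:M + m *: B) by [].
  rewrite scale_block_mx -[LHS]submxK; congr block_mx; apply/matrixP=> i j.
  - by rewrite !ord1 !mxE mulr1n.
  - rewrite !ord1 !mxE eqxx mulrA -dE /=; have [->|j0] := eqVneq j 0.
      by rewrite mulr1.
    by rewrite mulr0 M0.
  - by rewrite !ord1 !mxE (qE (_, _)) /= mulr0n add0r dE mulrA.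
  - rewrite !mxE (qE (_, _)) /= eq_rshift dE aE -mulrnAr.
    have -> : g * (a *+ (i == j) + m * (q (rshift 1 i, rshift 1 j) -
      k * ((i == 0) && (j == 0))%:R)) = g * (a *+ (i == j)) +
      g * m * q (rshift 1 i, rshift 1 j) -
      g * m * k * ((i == 0) && (j == 0))%:R by ring.
    by rewrite dk mul0r subr0.
have -> : \tr B = \tr B0 - k.
  rewrite raddfB /= mxtraceZ; congr (_ - _).
  rewrite -(mul_delta_mx (0 : 'I_1)) mxtrace_mulC mul_delta_mx.
  by rewrite /mxtrace big_ord1 mxE mulr1.
by rewrite mulrBr addrA kE mulrC subrr.
Qed.

End NormalForm.

Theorem mainTheorem2 (R : comPzRingType) (n : nat) (A : 'M[R]_n) :
  principal_ideal_ring R ->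
  (3 <= n)%N ->
  sl n R A ->
  exists X Y : 'M[R]_n,
    [/\ sl n R X,
        sl n R Y,
        X *m Y - Y *m X = A
      & forall p : maximal_ideal R, gl_regular (map_mx (residue p) X)].
Proof.
case: n A => [|[|[|n]]] // A pirR _ trA.
have [g [a [m [B [b [[P [Q [PQ AE]]] trB [x [y xy]]]]]]]] :=
  @conjugate_normal_form R pirR n A trA.
have QP := mulmx1C PQ.
have [Y [trY XY]] := explicit_commutator b trB.
set X := companion_extension _ _ in XY.
(* The factor [g] goes entirely into the second matrix, since the first must stay regular even where
   [g] vanishes. *)
exists (Q *m X *m P), (g *: (Q *m Y *m P)); split.
- by rewrite /sl /= mxtrace_mulC mulmxA PQ mul1mx companion_extension_trace.
- by rewrite /sl /= mxtraceZ mxtrace_mulC mulmxA PQ mul1mx trY mulr0.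
- have mulQP M M' : Q *m M *m P *m (Q *m M' *m P) = Q *m (M *m M') *m P.
    by rewrite !mulmxA -(mulmxA _ P Q) PQ mulmx1.
  rewrite -scalemxAr -scalemxAl !mulQP -scalerBr -mulmxBl -mulmxBr XY.
  rewrite scalemxAl scalemxAr AE !mulmxA QP mul1mx.
  by rewrite -mulmxA QP mulmx1.
- move=> p; rewrite !map_mxM.
  apply: (@gl_regular_conj _ n.+2); first by rewrite -map_mxM QP map_mx1.
  rewrite map_companion_extension; apply: companion_extension_regular.
  (* The last entry of the extension column is [- a]; being comaximal, [a] and [m] cannot both
     vanish modulo [p]. *)
  rewrite !mxE eqxx rmorphN oppr_eq0.
  have [a0|] := eqVneq (residue p a) 0; [right | by left].
  apply/eqP => m0; have := oner_neq0 (residue_field p).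
  rewrite -(rmorph1 (residue p)) xy rmorphD !rmorphM /= a0 m0.
  by rewrite !mulr0 addr0 eqxx.
Qed.
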